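(* Let $\mathcal G$ be a minimal locally compact Hausdorff étale groupoid with compact metrizable unit space. If $\mathcal G$ is almost elementary, then $\mathcal G$ has the groupoid small boundary property: for every $u\in\mathcal G^{(0)}$ and every open neighborhood $U$ of $u$ in $\mathcal G^{(0)}$ there is an open neighborhood $V$ of $u$ with $\overline V\subseteq U$ and $\mu(\partial V)=0$ for all $\mu\in M(\mathcal G)$.
   Context: $M(\mathcal G)$: the set of regular Borel probability measures $\mu$ on $\mathcal G^{(0)}$ with $\mu(s(U))=\mu(r(U))$ for every measurable bisection $U$ (a bisection is a subset of an open set on which $s,r$ restrict to homeomorphisms onto open subsets of $\mathcal G^{(0)}$). $AB=\{xy:x\in A,y\in B,s(x)=r(y)\}$. Minimal: no nontrivial proper closed invariant subsets of $\mathcal G^{(0)}$. Multisection: finite family $\{C_{i,j}:i,j\in F\}$ of bisections with $C_{i,j}C_{j,k}=C_{i,k}$ and pairwise disjoint levels $C_{i,i}\subseteq\mathcal G^{(0)}$; castle: finite family $\{C^l_{i,j}:i,j\in F_l,l\in I\}$ of multisections with $C^l_{i,j}C^{l'}_{i',j'}=\emptyset$ ($l\neq l'$). $\mathcal C$ $K$-extendable to $\mathcal D=\{D^l_{i,j}:i,j\in E_l,l\in I\}$: $F_l\subseteq E_l$, $C^l_{i,j}=D^l_{i,j}$ for $i,j\in F_l$, $K\cdot\bigcup\mathcal C\subseteq\bigcup\mathcal D$. $K\prec_{\mathcal G}V$: open bisections $A_1,\dots,A_n$ with $K\subseteq\bigcup s(A_i)$, $r(A_i)$ pairwise disjoint subsets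 of $V$. Almost elementary: for all compact $K\supseteq\mathcal G^{(0)}$, nonempty open $O$ and open covers $\mathcal V$ of $\mathcal G^{(0)}$ there are open castles $\mathcal C,\mathcal D$ with $\mathcal C$ $K$-extendable to $\mathcal D$, levels of $\mathcal D$ inside members of $\mathcal V$, and $\mathcal G^{(0)}\setminus\bigcup(\text{levels of }\mathcal C)\prec_{\mathcal G}O$. *)

(* Defs.v *)
From HB Require Import structures.
From mathcomp Require Import all_boot all_order all_algebra.
From mathcomp Require Import all_classical all_reals all_analysis.

Set Implicit Arguments.
Unset Strict Implicit.
Unset Printing Implicit Defensive.

Import Order.TTheory GRing.Theory Num.Theory.
Local Open Scope classical_set_scope.
Local Open Scope ring_scope.

Definition borel_type (X : ptopologicalType) := @g_sigma_algebraType X (@open X).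

(* Groupoid data: arrows in G, unit space is a separate space X, embedded
   into G by [unt]; G^(0) is the image [unt @` setT]. The multiplication
   [mlt x y] is only meaningful when [src x = rng y]. *)
Record groupoid_data (G X : Type) := GroupoidData {
  src : G -> X;
  rng : G -> X;
  unt : X -> G;
  mlt : G -> G -> G;
  inv : G -> G }.

Section Groupoids.
Context {G : topologicalType} {X : topologicalType} (g : groupoid_data G X).

Notation s := (src g).
Notation r := (rng g).
Notation u := (unt g).
Notation m := (mlt g).
Notation i := (inv g).

Definition groupoid_axioms : Prop :=
  [/\ (forall x, s (u x) = x /\ r (u x) = x),
      (forall a b, s a = r b -> s (m a b) = s b /\ r (m a b) = r a),
      (forall a b c, s a = r b -> s b = r c -> m (m a b) c = m a (m b c)),
      (forall a, m (u (r a)) a = a /\ m a (u (s a)) = a) &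
      (forall a, [/\ s (i a) = r a, r (i a) = s a,
                     m a (i a) = u (r a) & m (i a) a = u (s a)])].

Definition topological_groupoid : Prop :=
  [/\ groupoid_axioms, continuous s, continuous r, continuous u &
      (continuous i /\ {within [set p : G * G | s p.1 = r p.2], continuous (fun p => m p.1 p.2)})].

Definition etale : Prop :=
  forall a : G, exists W : set G,
    [/\ open W, W a, {in W &, injective s}, open (s @` W) &
        forall O, open O -> O `<=` W -> open (s @` O)].

Definition lch_etale_groupoid : Prop :=
  [/\ topological_groupoid, etale, hausdorff_space G &
      locally_compact [set: G]].

Definition open_bisection (W : set G) : Prop :=
  [/\ open W, {in W &, injective s}, {in W &, injective r} &
      forall O, open O -> O `<=` W -> open (s @` O) /\ open (r @` O)].

Definition bisection (U : set G) : Prop :=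
  exists W, open_bisection W /\ U `<=` W.

Definition gprod (A B : set G) : set G :=
  [set z | exists a b, [/\ A a, B b, s a = r b & z = m a b]].

Definition units : set G := u @` [set: X].

Definition invariant (A : set X) : Prop :=
  forall a : G, A (s a) -> A (r a).

Definition minimal : Prop :=
  forall A : set X, closed A -> invariant A -> A = set0 \/ A = [set: X].

Definition subequiv (K V : set X) : Prop :=
  exists (n : nat) (A : nat -> set G),
    [/\ (forall k, (k < n)%N -> open_bisection (A k)),
        K `<=` \bigcup_(k in [set k | (k < n)%N]) (s @` A k),
        (forall k, (k < n)%N -> r @` A k `<=` V) &
        (forall k k', (k < n)%N -> (k' < n)%N -> k <> k' ->
            r @` A k `&` r @` A k' = set0)].

(* Castles. A castle is indexed by a finite set I of "towers" (l \in I), each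
   with a finite index set F l; its members are C l i j (i, j \in F l). *)
Definition multisection (F : set nat) (C : nat -> nat -> set G) : Prop :=
  [/\ finite_set F,
      (forall a b, F a -> F b -> bisection (C a b)),
      (forall a b c, F a -> F b -> F c -> gprod (C a b) (C b c) = C a c),
      (forall a, F a -> C a a `<=` units) &
      (forall a b, F a -> F b -> a <> b -> C a a `&` C b b = set0)].

Definition castle (I : set nat) (F : nat -> set nat)
    (C : nat -> nat -> nat -> set G) : Prop :=
  [/\ finite_set I,
      (forall l, I l -> multisection (F l) (C l)) &
      (forall l l' a b a' b', I l -> I l' -> l <> l' ->
          F l a -> F l b -> F l' a' -> F l' b' ->
          gprod (C l a b) (C l' a' b') = set0)].

Definition open_castle I F C : Prop :=
  castle I F C /\ (forall l a b, I l -> F l a -> F l b -> open (C l a b)).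

Definition castle_union (I : set nat) (F : nat -> set nat)
    (C : nat -> nat -> nat -> set G) : set G :=
  [set z | exists l a b, [/\ I l, F l a, F l b & C l a b z]].

Definition castle_levels (I : set nat) (F : nat -> set nat)
    (C : nat -> nat -> nat -> set G) : set X :=
  [set x | exists l a, [/\ I l, F l a & C l a a (u x)]].

Definition extendable (K : set G) (I : set nat) (F E : nat -> set nat)
    (C D : nat -> nat -> nat -> set G) : Prop :=
  [/\ (forall l, I l -> F l `<=` E l),
      (forall l a b, I l -> F l a -> F l b -> C l a b = D l a b) &
      gprod K (castle_union I F C) `<=` castle_union I E D].

Definition open_cover (VV : set (set X)) : Prop :=
  (forall V, VV V -> open V) /\ \bigcup_(V in VV) V = [set: X].

Definition almost_elementary : Prop :=
  forall (K : set G) (O : set X) (VV : set (set X)),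
    compact K -> units `<=` K ->
    open O -> O !=set0 -> open_cover VV ->
    exists (I : set nat) (F E : nat -> set nat)
           (C D : nat -> nat -> nat -> set G),
      [/\ open_castle I F C, open_castle I E D, extendable K I F E C D,
          (forall l a, I l -> E l a ->
             exists2 V, VV V & [set x | D l a a (u x)] `<=` V) &
          subequiv (~` castle_levels I F C) O].

End Groupoids.

Section Measures.
Context {R : realType} {G : topologicalType} {X : ptopologicalType}
        (g : groupoid_data G X).
Local Open Scope ereal_scope.

Definition regular_measure (mu : set (borel_type X) -> \bar R) : Prop :=
  forall A : set (borel_type X), measurable A ->
    mu A = ereal_sup [set mu K | K in [set K : set X | compact K /\ K `<=` A]]
    /\ mu A = ereal_inf [set mu V | V in [set V : set X | open V /\ A `<=` V]].

Definition measurable_bisection (U : set G) : Prop :=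
  <<s @open G >> U /\ bisection g U.

Definition invariant_measures : set (probability (borel_type X) R) :=
  [set mu | regular_measure mu /\
     forall U, measurable_bisection U ->
       mu (src g @` U) = mu (rng g @` U)].

End Measures.

Definition boundary {T : topologicalType} (V : set T) : set T :=
  closure V `\` interior V.

(* Main.v *)
(* Minimality makes every orbit infinite (unless the unit space is finite, hence
   discrete), so there are nonempty open sets O that are uniformly small for all
   invariant measures. Almost elementariness then splits the unit space, up to
   an open set N with mu N <= mu O, into finitely many disjoint open levels as
   fine as we like: the leftover closed set is covered by sources of open
   bisections whose ranges are disjoint in O. Hence disjoint closed sets A and B
   have open neighborhoods U and V with disjoint closures such that the
   complement of U `|` V is uniformly small. Iterating on the closures of U and V
   gives, in the limit, disjoint open sets covering all but a set that is null
   for every invariant measure, and this set contains their boundaries. *)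

Require Import Defs.
From HB Require Import structures.
From mathcomp Require Import all_boot all_order all_algebra.
From mathcomp Require Import all_classical all_reals all_analysis.
Local Open Scope classical_set_scope.
Local Open Scope ring_scope.

Import Order.TTheory GRing.Theory Num.Theory.

(** * Separation in topological spaces *)

Lemma open_bigcap_lt {T : topologicalType} (n : nat) (F : nat -> set T) :
  (forall k, (k < n)%N -> open (F k)) -> open (\bigcap_(k in `I_n) F k).
Proof.
move=> oF; rewrite bigcap_mkord.
by apply: big_ind => [||i _]; [exact: openT | exact: openI | exact: oF].
Qed.

Lemma disjoint_open_closure {T : topologicalType} (A B : set T) :
  open B -> A `&` B = set0 -> closure A `&` B = set0.
Proof.
move=> oB AB0; rewrite -subset0 => z [Az Bz].
have [w] := Az B (open_nbhs_nbhs (conj oB Bz)).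
by rewrite AB0.
Qed.

(** Normality is used twice. Disjoint open neighborhoods of [A] and [B] only keep the closure of the
    first away from [B], so that closure is separated from [B] once more. *)
Lemma normal_separate_closures (R : realType) {T : topologicalType}
    (A B : set T) :
  normal_space T -> closed A -> closed B -> A `&` B = set0 ->
  exists U V : set T, [/\ open U, open V, A `<=` U, B `<=` V &
    closure U `&` closure V = set0].
Proof.
move=> /(@normal_openP R) nT cA cB AB0.
have [U [V [oU oV AU BV UV0]]] := nT _ _ cA cB AB0.
have cUV0 := disjoint_open_closure _ _ oV UV0.
have cUB0 : closure U `&` B = set0.
  by rewrite -subset0 -cUV0; exact: setIS.
have [U' [V' [oU' oV' UU' BV' UV'0]]] := nT _ _ (@closed_closure _ U) cB cUB0.
exists U, V'; split => //.
have V'U'0 : closure V' `&` U' = set0.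
  by apply: disjoint_open_closure => //; rewrite setIC.
by rewrite -subset0 -V'U'0 setIC; exact: setIS.
Qed.

Lemma disjoint_open_neighborhoods {T : topologicalType} (p : nat -> T) :
  hausdorff_space T -> injective p -> forall n : nat,
  exists N : nat -> set T,
    [/\ forall k, open (N k), forall k, N k (p k) &
        trivIset `I_n N].
Proof.
rewrite open_hausdorff => hT pI n.
have /choice[S HS] : forall kj : nat * nat, exists UV : set T * set T,
    [/\ open UV.1, open UV.2, UV.1 (p kj.1), UV.2 (p kj.2) &
        kj.1 != kj.2 -> UV.1 `&` UV.2 = set0].
  (* Diagonal pairs receive the whole space, so that they impose no restriction below. *)
  move=> [k j] /=; have [<-|kj] := eqVneq k j.
    by exists (setT, setT); split => //; exact: openT.
  have /hT[[U V] /= [/set_mem Uk /set_mem Vj] [oU oV /eqP UV0]] : p k != p j.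
    by apply: contra_neq kj => /pI.
  by exists (U, V).
(* Both orders of each pair are intersected, so the separation chosen for (i, j) bounds [N i] by its
   first set and [N j] by its second. *)
pose N k := \bigcap_(j in `I_n) ((S (k, j)).1 `&` (S (j, k)).2).
exists N; split => [k|k j jn|i j ilt jlt [z [Ni Nj]]].
- apply: open_bigcap_lt => j _.
  by apply: openI; [case: (HS (k, j)) | case: (HS (j, k))].
- by split; [case: (HS (k, j)) | case: (HS (j, k))].
- apply/eqP/negPn/negP => ij.
  have [_ _ _ _ /(_ ij) UV0] := HS (i, j).
  have [Uz _] := Ni j jlt; have [_ Vz] := Nj i ilt.
  by suff : set0 z by []; rewrite -UV0.
Qed.

(** * Inverses and open bisections *)

(** With a' the inverse of a and a'' that of a', associativity gives a'' = a''(a'a) = (a''a')a =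
    a. *)
Lemma groupoid_invK {G X : topologicalType} (g : groupoid_data G X) :
  groupoid_axioms g -> involutive (Defs.inv g).
Proof.
case=> _ _ mA m1 mi a.
have [sia ria _ iaa] := mi a; have [siia _ _ iiaia] := mi (Defs.inv g a).
rewrite -[LHS](m1 _).2 siia ria -iaa -mA ?iiaia ?siia ?ria //.
by rewrite sia (m1 a).1.
Qed.

(** Étaleness controls the source only. Since the range is the source of the inverse, a neighborhood
    good for the source at [a] is intersected with the inverse image of one good at the inverse of
    [a]. *)
Lemma open_bisection_at {G X : topologicalType} (g : groupoid_data G X) :
  topological_groupoid g -> etale g ->
  forall a : G, exists2 W, open_bisection g W & W a.
Proof.
move=> [gax _ _ _ [ci _]] et a.
have iK := groupoid_invK g gax.
have [_ _ _ _ mi] := gax.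
have rE b : rng g b = src g (Defs.inv g b) by case: (mi b).
have [W1 [oW1 W1a sI1 _ sO1]] := et a.
have [W2 [oW2 W2a sI2 _ sO2]] := et (Defs.inv g a).
have oi O : open O -> open (Defs.inv g @^-1` O).
  by move/continuousP: ci; apply.
exists (W1 `&` Defs.inv g @^-1` W2) => //; split.
- by apply: openI => //; exact: oi.
- move=> b c /set_mem[b1 _] /set_mem[c1 _].
  by apply: sI1; exact: mem_set.
- move=> b c /set_mem[_ b2] /set_mem[_ c2]; rewrite !rE => /sI2 bc.
  by apply: (can_inj iK); apply: bc; exact: mem_set.
- move=> O oO OW; split; first by apply: sO1 => // z /OW[].
  have -> : rng g @` O = src g @` (Defs.inv g @^-1` O).
    rewrite eqEsubset; split => z [b Ob <-].
      by exists (Defs.inv g b); rewrite ?rE //= iK.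
    by exists (Defs.inv g b); rewrite ?rE //= iK.
  by apply: sO2; [exact: oi | move=> b /OW[_] /=; rewrite iK].
Qed.

Lemma sub_open_bisection {G X : topologicalType} (g : groupoid_data G X)
    (W O : set G) :
  open_bisection g W -> open O -> O `<=` W -> open_bisection g O.
Proof.
move=> [_ sI rI WO] oO OW; split => //.
- by move=> b c /set_mem/OW/mem_set Wb /set_mem/OW/mem_set Wc; exact: sI.
- by move=> b c /set_mem/OW/mem_set Wb /set_mem/OW/mem_set Wc; exact: rI.
- by move=> P oP PO; apply: WO => // z /PO/OW.
Qed.

(** * Borel sets and invariant measures *)

Lemma measurable_open_borel {X : ptopologicalType} (A : set (borel_type X)) :
  @open X A -> measurable A.
Proof. exact: sub_sigma_algebra. Qed.

Lemma measurable_closed_borel {X : ptopologicalType} (A : set (borel_type X)) :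
  @closed X A -> measurable A.
Proof.
move=> cA; rewrite -[A]setCK; apply: measurableC.
by apply: measurable_open_borel; exact: closed_openC.
Qed.

Lemma invariant_measure_open_bisection {R : realType} {G : topologicalType}
    {X : ptopologicalType} (g : groupoid_data G X)
    (mu : probability (borel_type X) R) (W : set G) :
  invariant_measures g mu -> open_bisection g W ->
  mu (src g @` W) = mu (rng g @` W).
Proof.
move=> [_ inv_mu] bW; apply: inv_mu; split; last by exists W; split=> [|z].
by apply: sub_sigma_algebra; case: bW.
Qed.

(** * Orbits and uniformly small open sets *)

(** A finite orbit would be closed, invariant and nonempty, hence by minimality the whole infinite
    unit space. *)
Lemma infinite_orbit {G X : topologicalType} (g : groupoid_data G X) (y : X) :
  groupoid_axioms g -> hausdorff_space X -> minimal g ->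
  infinite_set [set: X] ->
  infinite_set [set rng g a | a in [set a | src g a = y]].
Proof.
move=> [us gm _ _ _] hX min infX finO; apply: infX.
set O := [set rng g a | a in _] in finO.
have cO : closed O.
  by apply: ((@accessible_finite_set_closed X).1 _) => //; exact: hausdorff_accessible.
have iO : Defs.invariant g O.
  move=> b [a /= say rab].
  by have [sba rba] := gm b a (esym rab); exists (mlt g b a); rewrite //= sba.
have [E0|ET] := min O cO iO; last by rewrite -ET.
have [suy ruy] := us y.
have : O y by exists (unt g y).
by rewrite E0.
Qed.

(* Around an arrow with source y and range each of n + 1 points of the orbit of
   y there are open bisections with a common source O and disjoint ranges, so
   O has n + 1 disjoint copies of the same measure. *)
Lemma small_open_set (R : realType) {G : topologicalType}
    {X : ptopologicalType} (g : groupoid_data G X) (y : X) (n : nat) :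
  topological_groupoid g -> etale g -> hausdorff_space X -> minimal g ->
  infinite_set [set: X] ->
  exists O : set X, [/\ open O, O y &
    forall mu : probability (borel_type X) R, invariant_measures g mu ->
      (mu O <= (n.+1%:R^-1)%:E)%E].
Proof.
move=> tg et hX min infX.
have [gax cs cr _ _] := tg.
(* [p] enumerates distinct points of the orbit of [y]. *)
have /infiniteP/pcard_leP/unsquash p := infinite_orbit g y gax hX min infX.
have pI : injective p by move=> i j ij; apply: (inj (f := p)); rewrite ?inE.
have /choice[a Ha] : forall k, exists a, src g a = y /\ rng g a = p k.
  by move=> k; have [a /= ? <-] : _ (p k) := @funS _ _ _ _ p k I; exists a.
have [N [oN Np trivN]] := disjoint_open_neighborhoods p hX pI n.+1.
have /choice[W HW] : forall k, exists W, open_bisection g W /\ W (a k).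
  by move=> k; have [W] := open_bisection_at g tg et (a k); exists W.
pose W' k := W k `&` rng g @^-1` N k.
have oW' k : open (W' k).
  apply: openI; first by case: (HW k) => -[].
  by move/continuousP: cr; exact.
have bW' k : open_bisection g (W' k).
  by apply: sub_open_bisection (HW k).1 _ _ => // z [].
pose O := \bigcap_(k in `I_n.+1) (src g @` W' k).
have oO : open O.
  apply: open_bigcap_lt => k _; have [_ _ _ b] := bW' k.
  by have [] := b (W' k) (oW' k).
have Oy : O y.
  move=> k _; have [sa ra] := Ha k; exists (a k) => //.
  by split; [case: (HW k) | rewrite /= ra].
exists O; split => // mu inv_mu.
(* Cutting down to [O] makes every source exactly [O]; the ranges stay inside the disjoint sets
   [N k]. *)
pose M k := W' k `&` src g @^-1` O.
have oM k : open (M k) by apply: openI => //; move/continuousP: cs; exact.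
have bM k : open_bisection g (M k) by apply: sub_open_bisection (bW' k) _ _ => // z [].
have sM k : (k < n.+1)%N -> src g @` M k = O.
  move=> kn; rewrite eqEsubset; split => [z [b [_ Ob] <-]//|z Oz].
  by have [b W'b sb] := Oz k kn; exists b; rewrite // /M; split; rewrite //= sb.
pose T k : set (borel_type X) := rng g @` M k.
have mrM k : measurable (T k).
  by apply: measurable_open_borel; have [_ _ _ b] := bM k; have [] := b (M k) (oM k).
have trivM : trivIset `I_n.+1 T.
  move=> i j iI jI [z [[b [[_ Nb] _] <-] [c [[_ Nc] _] cb]]].
  by apply: trivN => //; exists (rng g b); split => //; rewrite -cb.
have mU : measurable (\big[setU/set0]_(k < n.+1) T k).
  by apply: bigsetU_measurable => k _.
(* The n + 1 disjoint ranges each have measure [mu O], and their union has measure at most 1. *)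
have := probability_le1 mu mU.
rewrite (measure_semi_additive_ord_I mu (F := T)) //.
rewrite (eq_bigr (fun=> mu (O : set (borel_type X)))); last first.
  move=> k _; rewrite -(sM k) //; exact/esym/invariant_measure_open_bisection.
have fO : mu (O : set (borel_type X)) \is a fin_num.
  by apply: fin_num_measure; exact: measurable_open_borel.
rewrite -(fineK fO) sumEFin !lee_fin sumr_const card_ord.
by rewrite -[X in X <= 1]mulr_natr -ler_pdivlMr ?ltr0n // div1r.
Qed.

(** * Subequivalence, castles and separation up to small measure *)

(** [N] is the union of the sources of the bisections. Subadditivity bounds its measure by the sum
    over sources, invariance turns this into the sum over ranges, and these are disjoint in [O]. *)
Lemma measure_subequiv {R : realType} {G : topologicalType}
    {X : ptopologicalType} (g : groupoid_data G X) (K O : set X) :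
  open O -> subequiv g K O ->
  exists N : set X, [/\ open N, K `<=` N &
    forall mu : probability (borel_type X) R, invariant_measures g mu ->
      (mu N <= mu O)%E].
Proof.
move=> oO [n [A [bA KA rA trivA]]].
have oA k : (k < n)%N -> open (src g @` A k) /\ open (rng g @` A k).
  by move=> kn; have [oAk _ _ b] := bA k kn; exact: b.
exists (\bigcup_(k in `I_n) (src g @` A k)); split => //.
  by apply: bigcup_open => k kn; have [] := oA k kn.
move=> mu inv_mu.
pose S k : set (borel_type X) := src g @` A k.
pose T k : set (borel_type X) := rng g @` A k.
have ms k : (k < n)%N -> measurable (S k).
  by move=> kn; apply: measurable_open_borel; have [] := oA k kn.
have mr k : (k < n)%N -> measurable (T k).
  by move=> kn; apply: measurable_open_borel; have [] := oA k kn.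
have mUr : measurable (\big[setU/set0]_(k < n) (T k)).
  by apply: bigsetU_measurable => k _; exact: mr.
rewrite bigcup_mkord.
apply: (@le_trans _ _ (\sum_(k < n) mu (S k))%E).
  apply: content_subadditive => //.
  by apply: bigsetU_measurable => k _; exact: ms.
rewrite (eq_bigr (fun k : 'I_n => mu (T k))); last first.
  by move=> k _; apply: invariant_measure_open_bisection => //; exact: bA.
rewrite -(measure_semi_additive_ord_I mu (F := T)) //; last first.
  move=> i j iI jI [z rz]; apply/eqP/negPn/negP => /eqP ij.
  by rewrite trivA in rz.
apply: le_measure; rewrite ?inE //; first exact: measurable_open_borel.
by rewrite -bigcup_mkord => z [k kn]; exact: rA.
Qed.

(** A unit lying in levels of two different towers would, multiplied by itself, give an element of
    their empty product. *)
Lemma castle_levels_disjoint {G X : topologicalType} (g : groupoid_data G X)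
    (I : set nat) (F : nat -> set nat) (C : nat -> nat -> nat -> set G) :
  groupoid_axioms g -> castle g I F C ->
  forall l a l' a' x, I l -> F l a -> I l' -> F l' a' ->
    C l a a (unt g x) -> C l' a' a' (unt g x) -> l = l' /\ a = a'.
Proof.
move=> [us _ _ _ _] [_ ms dis] l a l' a' x Il Fa Il' Fa' Cx C'x.
have ll' : l = l'.
  apply/eqP/negPn/negP => /eqP ll'.
  have [sx rx] := us x.
  suff : set0 (mlt g (unt g x) (unt g x)) by [].
  rewrite -(dis l l' a a a' a' Il Il' ll' Fa Fa Fa' Fa').
  by exists (unt g x), (unt g x); rewrite sx rx.
subst l'; split => //; apply/eqP/negPn/negP => /eqP aa'.
have [_ _ _ _ d] := ms l Il.
by suff : set0 (unt g x) by []; rewrite -(d a a' Fa Fa' aa').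
Qed.

(* Castle levels fine enough to miss A or B are assigned to P or Q; outside the
   small open set N they fill everything, so A and B grow there while remaining
   closed and disjoint. *)
Lemma separation_up_to_small_measure (R : realType) {G : topologicalType}
    {X : ptopologicalType} (g : groupoid_data G X) (n : nat) (A B : set X) :
  lch_etale_groupoid g -> hausdorff_space X -> compact [set: X] ->
  minimal g -> almost_elementary g -> infinite_set [set: X] ->
  closed A -> closed B -> A `&` B = set0 ->
  exists U V : set X, [/\ open U, open V, A `<=` U, B `<=` V &
    closure U `&` closure V = set0 /\
    forall mu : probability (borel_type X) R, invariant_measures g mu ->
      (mu (~` (U `|` V)) <= (n.+1%:R^-1)%:E)%E].
Proof.
move=> [tg et _ _] hX cX min ae infX cA cB AB0.
have [gax _ _ cu _] := tg.
have [ O [oO Oy muO]] := small_open_set R g point n tg et hX min infX.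
have cunits : compact (units g).
  by apply: continuous_compact => //; exact: continuous_subspaceT.
(* The complements of [A] and [B] cover the space because [A] and [B] are disjoint; refining this
   cover forces every level to miss one of them. *)
have [|I [F [E [C [D [[cC oC] _ [FE CD _] small sub]]]]]] :=
    ae (units g) O [set ~` A; ~` B] cunits (fun=> id) oO (ex_intro _ _ Oy).
  split=> [V [->|->]|]; [exact: closed_openC|exact: closed_openC|].
  rewrite -subTset => z _; have [Az|nAz] := pselect (A z).
    exists (~` B); [by right|] => Bz.
    by suff : set0 z by []; rewrite -AB0.
  by exists (~` A); [left|].
have [N [oN KN muN]] := measure_subequiv (R := R) g _ _ oO sub.
pose L l a := [set x | C l a a (unt g x)].
have oL l a : I l -> F l a -> open (L l a).
  by move=> Il Fa; move/continuousP: cu; apply; exact: oC.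
(* Levels missing both sets go to [P], so [P] and [Q] never share a level. *)
pose P := [set x | exists l a, [/\ I l, F l a, L l a `<=` ~` B & L l a x]].
pose Q := [set x | exists l a, [/\ I l, F l a, ~ (L l a `<=` ~` B) & L l a x]].
have oP : open P.
  have -> : P = \bigcup_(la in [set la : nat * nat | [/\ I la.1, F la.1 la.2 &
      L la.1 la.2 `<=` ~` B]]) L la.1 la.2.
    rewrite eqEsubset; split => [z [l [a []]]|z [[l a] []]]; first by exists (l, a).
    by exists l, a.
  by apply: bigcup_open => -[l a] [Il Fa _]; exact: oL.
have oQ : open Q.
  have -> : Q = \bigcup_(la in [set la : nat * nat | [/\ I la.1, F la.1 la.2 &
      ~ (L la.1 la.2 `<=` ~` B)]]) L la.1 la.2.
    rewrite eqEsubset; split => [z [l [a []]]|z [[l a] []]]; first by exists (l, a).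
    by exists l, a.
  by apply: bigcup_open => -[l a] [Il Fa _]; exact: oL.
have PQ0 z : P z -> Q z -> False.
  move=> [l [a [Il Fa LB Lz]]] [l' [a' [Il' Fa' LB' Lz']]].
  have [ll' aa'] := castle_levels_disjoint g I F C gax cC l a l' a' z
    Il Fa Il' Fa' Lz Lz'.
  by apply: LB'; rewrite -ll' -aa'.
have PB z : P z -> ~ B z by move=> [l [a [_ _ LB /LB]]].
have QA z : Q z -> ~ A z.
  move=> [l [a [Il Fa LB Lz]]].
  have [V [->|->]] := small l a Il (FE l Il a Fa); rewrite -CD //.
  by move=> LA; exact: LA.
have PQN z : ~ N z -> P z \/ Q z.
  move=> /(contra_not (KN z))/contrapT[l [a [Il Fa Lz]]].
  by have [LB|LB] := pselect (L l a `<=` ~` B); [left|right]; exists l, a.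
(* Outside [N] the sets [P] and [Q] partition the space, so what is added to [A] is the part of [P]
   outside [N], written as a complement to make it visibly closed. The two enlarged sets together
   contain everything outside [N]. *)
have cA' : closed (A `|` ~` (Q `|` N)).
  by apply: closedU => //; apply: open_closedC; exact: openU.
have cB' : closed (B `|` ~` (P `|` N)).
  by apply: closedU => //; apply: open_closedC; exact: openU.
have AB'0 : (A `|` ~` (Q `|` N)) `&` (B `|` ~` (P `|` N)) = set0.
  rewrite -subset0 => z [[Az|/not_orP[nQ nN]] [Bz|/not_orP[nP nN']]].
  - by rewrite -AB0.
  - by have [//|/QA] := PQN z nN'.
  - by have [/PB|//] := PQN z nN.
  - by have [] := PQN z nN.
have nX : normal_space X := compact_normal hX cX.
have [U [V [oU oV AU BV UV0]]] := normal_separate_closures R _ _ nX cA' cB' AB'0.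
exists U, V; split => //; [by move=> z Az; apply: AU; left|by move=> z Bz; apply: BV; left|].
split => // mu inv_mu.
apply: le_trans (muO mu inv_mu); apply: le_trans (muN mu inv_mu).
apply: le_measure; rewrite ?inE.
- by apply: measurable_closed_borel; apply: open_closedC; exact: openU.
- exact: measurable_open_borel.
- move=> z /not_orP[nU nV]; apply: contrapT => nN.
  have [Pz|Qz] := PQN z nN.
    by apply: nU; apply: AU; right => -[/(PQ0 _ Pz)|].
  by apply: nV; apply: BV; right => -[/PQ0/(_ Qz)|].
Qed.

(** * Passage to the limit and the small boundary property *)

Lemma null_boundary_separation (R : realType) (G : topologicalType)
    (X : ptopologicalType) (g : groupoid_data G X) :
  lch_etale_groupoid g ->
  hausdorff_space X -> compact [set: X] ->
  minimal g ->
  almost_elementary g ->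
  infinite_set [set: X] ->
  forall A B : set X, closed A -> closed B -> A `&` B = set0 ->
    exists V : set X,
      [/\ open V, A `<=` V, closure V `&` B = set0 &
          forall mu : probability (borel_type X) R,
            invariant_measures g mu -> mu (boundary V) = 0%E].
Proof.
move=> lg hX cX min ae infX A B cA cB AB0.
(* Choice needs a total function, so the hypotheses on the pair are moved into the specification,
   and a pair violating them gets two empty sets. *)
have /choice[f Hf] : forall nAB : nat * (set X * set X),
    exists UV : set X * set X,
    let: (n, (A, B)) := nAB in
    closed A -> closed B -> A `&` B = set0 ->
    [/\ open UV.1, open UV.2, A `<=` UV.1, B `<=` UV.2 &
    closure UV.1 `&` closure UV.2 = set0 /\
    forall mu : probability (borel_type X) R, invariant_measures g mu ->
      (mu (~` (UV.1 `|` UV.2)) <= (n.+1%:R^-1)%:E)%E].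
  move=> [n [A' B']].
  have [[cA' cB' AB0']|h] := pselect ([/\ closed A', closed B' & A' `&` B' = set0]).
    have [U [V HUV]] := separation_up_to_small_measure R g n A' B'
      lg hX cX min ae infX cA' cB' AB0'.
    by exists (U, V).
  by exists (set0, set0) => cA' cB' AB0'; case: h.
(* Stage n leaves out measure at most 1/(n + 1). Feeding the closures into the next stage makes both
   sequences increasing. *)
pose s := fix s n := if n is m.+1
  then f (m.+1, (closure (s m).1, closure (s m).2)) else f (0%N, (A, B)).
have sP n : [/\ open (s n).1, open (s n).2,
    closure (s n).1 `&` closure (s n).2 = set0 &
    forall mu : probability (borel_type X) R, invariant_measures g mu ->
      (mu (~` ((s n).1 `|` (s n).2)) <= (n.+1%:R^-1)%:E)%E].
  elim: n => [|n [oU oV UV0 _]].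
    by have [? ? _ _ []] := Hf (0%N, (A, B)) cA cB AB0.
  by have [? ? _ _ []] := Hf (n.+1, (closure (s n).1, closure (s n).2))
    (@closed_closure _ _) (@closed_closure _ _) UV0.
have sS n : (s n).1 `<=` (s n.+1).1 /\ (s n).2 `<=` (s n.+1).2.
  have [_ _ UV0 _] := sP n.
  have [_ _ U V _] := Hf (n.+1, (closure (s n).1, closure (s n).2))
    (@closed_closure _ _) (@closed_closure _ _) UV0.
  by split; apply: subset_trans (@subset_closure _ _) _.
have smono n m : (n <= m)%N -> (s n).1 `<=` (s m).1 /\ (s n).2 `<=` (s m).2.
  move=> /subnK <-; elim: (m - n)%N => [|k [IH1 IH2]]; first by split=> z.
  by rewrite addSn; have [S1 S2] := sS (k + n)%N; split;
    [exact: subset_trans IH1 S1|exact: subset_trans IH2 S2].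
pose V := \bigcup_n (s n).1; pose W := \bigcup_n (s n).2.
have oV : open V by apply: bigcup_open => n _; have [] := sP n.
have oW : open W by apply: bigcup_open => n _; have [] := sP n.
have VW0 : V `&` W = set0.
  rewrite -subset0 => z [[n _ Vz] [m _ Wz]].
  (* By monotonicity both memberships hold at the common stage [maxn n m], where the closures are
     disjoint. *)
  have [_ _ <- _] := sP (maxn n m).
  split; apply: subset_closure.
    by apply: (smono n _ _).1 => //; exact: leq_maxl.
  by apply: (smono m _ _).2 => //; exact: leq_maxr.
have cVW0 := disjoint_open_closure _ _ oW VW0.
have [_ _ AV BW _] := Hf (0%N, (A, B)) cA cB AB0.
exists V; split => //.
- by move=> z Az; exists 0%N => //; exact: AV.
- rewrite -subset0 -cVW0; apply: setIS => z Bz.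
  by exists 0%N => //; exact: BW.
move=> mu inv_mu; rewrite /boundary (interior_id V).1 //.
have mbd : measurable (closure V `\` V : set (borel_type X)).
  rewrite setDE; apply: measurable_closed_borel; apply: closedI.
    exact: closed_closure.
  exact: open_closedC.
(* The boundary of [V] misses [V], and also [W] since [W] is open and disjoint from [V]; hence it
   lies in the remainder of every stage. *)
have bd n : (mu (closure V `\` V : set (borel_type X)) <= (n.+1%:R^-1)%:E)%E.
  have [oU oV' _ mun] := sP n.
  apply: le_trans (mun mu inv_mu); apply: le_measure; rewrite ?inE //.
    by apply: measurable_closed_borel; apply: open_closedC; exact: openU.
  move=> z [cVz nVz] [Uz|Wz]; first by apply: nVz; exists n.
  by suff : set0 z by []; rewrite -cVW0; split => //; exists n.
have fbd : mu (closure V `\` V : set (borel_type X)) \is a fin_num.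
  exact: fin_num_measure.
apply/eqP; rewrite eq_le measure_ge0 andbT.
move: bd; rewrite -(fineK fbd); set c := fine _ => bd.
rewrite lee_fin leNgt; apply/negP => c0.
(* For c > 0 this index satisfies n + 1 > 1/c, so the bound at n contradicts 1/(n + 1) < c. *)
have := bd (Num.truncn c^-1); rewrite lee_fin leNgt => /negP; apply.
by rewrite -[ltRHS]invrK ltf_pV2 ?posrE ?invr_gt0 ?ltr0n // truncnS_gt.
Qed.

Theorem theorem7p9 (R : realType) (G : topologicalType)
    (X : pseudoPMetricType R) (g : groupoid_data G X) :
  lch_etale_groupoid g ->
  hausdorff_space X -> compact [set: X] ->
  minimal g ->
  almost_elementary g ->
  forall (x : X) (U : set X), open U -> U x ->
    exists V : set X,
      [/\ open V, V x, closure V `<=` U &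
          forall mu : probability (borel_type X) R,
            invariant_measures g mu -> mu (boundary V) = 0%E].
Proof.
move=> lg hX cX min ae x U oU Ux.
have finC (A : set X) : finite_set A -> closed A.
  move: A; apply: ((@accessible_finite_set_closed X).1 _).
  exact: hausdorff_accessible.
(* A finite Hausdorff unit space is discrete, so the singleton of [x] is clopen with empty
   boundary. *)
have [finX|infX] := pselect (finite_set [set: X]).
  have cS (A : set X) : closed A by apply: finC; exact: sub_finite_set finX.
  have oS (A : set X) : open A by rewrite -[A]setCK; exact: closed_openC.
  exists [set x]; split => //.
    by rewrite -(closure_id _).1 // => _ ->.
  move=> mu _.
  by rewrite /boundary -(closure_id _).1 // (interior_id _).1 // setDv measure0.
(* In the infinite case, the point is separated from the complement of [U]. *)
have xU0 : [set x] `&` ~` U = set0 by rewrite -subset0 => z [-> /(_ Ux)].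
have [V [oV xV VU muV]] := null_boundary_separation R G X g lg hX cX min ae infX
  [set x] (~` U) (finC _ (finite_set1 x)) (open_closedC oU) xU0.
exists V; split => //; first exact: xV.
by move=> z Vz; apply: contrapT => nUz; suff : set0 z by []; rewrite -VU.
Qed.
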